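(* There exists an absolute constant $c$ such that the following holds. Let $\mathbb{F}$ be an arbitrary field and let $\mathfrak{L}_1,\mathfrak{L}_2,\mathfrak{L}_3$ be finite collections of $L_1$, $L_2$ and $L_3$ lines in $\mathbb{F}^3$, respectively. Then $$|J(\mathfrak{L}_1,\mathfrak{L}_2,\mathfrak{L}_3)|\le c\,(L_1L_2L_3)^{1/2}.$$
   Context: For finite collections $\mathfrak{L}_1,\ldots,\mathfrak{L}_n$ of lines in $\mathbb{F}^n$, a point $x\in\mathbb{F}^n$ is a multijoint formed by them if for each $i=1,\ldots,n$ there is a line $l_i\in\mathfrak{L}_i$ passing through $x$ such that the directions of $l_1,\ldots,l_n$ span $\mathbb{F}^n$. $J(\mathfrak{L}_1,\ldots,\mathfrak{L}_n)$ denotes the set of such multijoints. *)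

(* Defs.v *)
From mathcomp Require Import all_boot all_order all_algebra finmap.
From mathcomp Require Import boolp classical_sets cardinality reals.
Set Implicit Arguments.
Unset Strict Implicit.
Unset Printing Implicit Defensive.
Import GRing.Theory Num.Theory.
Local Open Scope ring_scope.
Local Open Scope classical_set_scope.

Definition line_through (F : fieldType) (n : nat) (p v : 'rV[F]_n) :
    set 'rV[F]_n :=
  [set p + t *: v | t in [set: F]].

(* A direction of a line is unique only up to a nonzero scalar factor. *)
Definition is_direction (F : fieldType) (n : nat) (l : set 'rV[F]_n)
    (v : 'rV[F]_n) : Prop :=
  v != 0 /\ exists p, l = line_through p v.

Definition is_line (F : fieldType) (n : nat) (l : set 'rV[F]_n) : Prop :=
  exists v, is_direction l v.

Definition multijoints (F : fieldType) (n : nat)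
    (L : 'I_n -> {fset (set 'rV[F]_n)}) : set 'rV[F]_n :=
  [set x | exists l : 'I_n -> set 'rV[F]_n,
    (forall i, l i \in L i /\ l i x) /\
    exists v : 'I_n -> 'rV[F]_n,
      (forall i, is_direction (l i) (v i)) /\
      <<[seq v i | i : 'I_n]>>%VS = fullv].

(* Main.v *)
(** Fix a handicap beta : J -> nat.  A line l, with degree budget D, is flooded
    up to the least level w at which the volume sum_(q in l) (w - beta q)
    exceeds D, and a multijoint p of l receives the share w - beta p.  Let f be
    a nonzero polynomial of degree at most D and let p minimise
    ord_p f + beta p.  Restricting to the lines through p the derivatives of f
    at p of order ord_p f, and counting zeros with multiplicity, shows that in
    the frame given by its three lines, f has a nonzero coefficient at p whose
    exponents lie below the three shares of p.  Hence these coefficients cannot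
    all be killed, and the products of the three shares sum to at least
    'C(D + 3, 3).
    Taking D = 12 n for n = #|J|, we may thus keep raising the handicap of some
    p whose product of shares exceeds lam = 288 n^2.  If the configuration is
    connected, then handicaps stay bounded as long as one of them is zero; so at
    some point all have been raised, all products of shares are large, and
    Hoelder's inequality together with the budget O(D) of each line gives
    n^2 <= 10 L1 L2 L3.  Disconnected configurations follow by superadditivity.
    The handicaps are those of Tidor, Yu and Zhao. *)

Require Import Defs.
From mathcomp Require Import all_boot all_order all_algebra.
From mathcomp Require Import mpoly boolp zify.
Set Implicit Arguments.
Unset Strict Implicit.
Unset Printing Implicit Defensive.
Import GRing.Theory Num.Theory.

(** * Water levels *)

Section WaterLevel.
Variables (J : finType) (D : nat).
Implicit Types (B : {set J}) (beta : J -> nat).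

Definition volume beta B v := \sum_(q in B) (v - beta q).

(** Guarding by [B != set0] keeps [level] total: the empty set gets level 0. *)
Lemma level_exists beta B : exists v, (B != set0) ==> (D < volume beta B v).
Proof.
exists (D.+1 + \sum_q beta q); apply/implyP=> /set0Pn[q qB].
rewrite /volume (bigD1 q) //= [X in _ + X - _](bigD1 q) //=; lia.
Qed.

Definition level beta B := ex_minn (level_exists beta B).

Lemma volume_mono beta B v w : v <= w -> volume beta B v <= volume beta B w.
Proof. by move=> vw; apply: leq_sum => q _; exact: leq_sub2r. Qed.

Lemma levelP beta B v : B != set0 ->
  (v < level beta B) = (volume beta B v <= D).
Proof.
move=> B0; rewrite /level; case: ex_minnP => m; rewrite B0 /= => Dm m_min.
apply/idP/idP => [vm|vD].
  by rewrite leqNgt; apply/negP => /m_min; rewrite leqNgt vm.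
by rewrite ltnNge; apply: contraL Dm => mv; rewrite -leqNgt (leq_trans (volume_mono _ _ mv)).
Qed.

Lemma level_anti beta beta' B : B != set0 -> (forall q, beta q <= beta' q) ->
  level beta B <= level beta' B.
Proof.
move=> B0 le_b; case E: (level beta B) => [//|v].
rewrite levelP // (@leq_trans (volume beta B v)) //.
  by apply: leq_sum => q _; exact: leq_sub2l.
by rewrite -levelP // E.
Qed.

(** One step below the level the volume is at most [D]; the last step and the successor cost each
    point at most one unit apiece. *)
Lemma sum_share_le beta B : B != set0 ->
  \sum_(q in B) (level beta B - beta q).+1 <= D + 2 * #|B|.
Proof.
move=> B0; have : 0 < level beta B.
  by rewrite levelP // /volume big1 // => q _; rewrite sub0n.
case E: (level beta B) => [//|v] _.
have vD : volume beta B v <= D by rewrite -levelP // E.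
apply: (@leq_trans (\sum_(q in B) ((v - beta q) + 2))).
  by apply: leq_sum => q _; lia.
by rewrite big_split /= sum_nat_const mulnC leq_add2r.
Qed.

(** Height [beta p] is still below the level, so the term [beta p - beta q] of the volume there is
    at most [D]. *)
Lemma share_gap beta B p q : p \in B -> q \in B ->
  0 < level beta B - beta p -> beta p <= beta q + D.
Proof.
move=> pB qB; rewrite subn_gt0 levelP; last by apply/set0Pn; exists p.
by rewrite /volume (bigD1 q) //=; lia.
Qed.

End WaterLevel.

(** * Three-term inequalities over the naturals *)

Lemma nat_AGM3 x y z : 27 * (x * y * z) <= (x + y + z) ^ 3.
Proof.
wlog xy : x y / x <= y => [H|].
  by have [/H//|/ltnW/H] := leqP x y; rewrite (mulnC y) (addnC y).
wlog yz : x y z xy / y <= z => [H|].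
  have [yz|/ltnW zy] := leqP y z; first exact: H.
  have [xz|/ltnW zx] := leqP x z.
    by have := H _ _ _ xz zy; rewrite (mulnAC x) (addnAC x).
  by have := H _ _ _ zx xy; rewrite -addnA addnC -mulnA [z * _]mulnC.
(* In [x], [x + a], [x + a + b] the difference of the two sides has nonnegative coefficients. *)
rewrite -(subnKC yz) -(subnKC xy); move: (y - x) (z - _) => a b.
rewrite !expnS expn0; nia.
Qed.

Lemma exists_le_average (J : finType) (A : {set J}) (y : J -> nat) :
  A != set0 -> exists2 p, p \in A & #|A| * y p <= \sum_(q in A) y q.
Proof.
move=> /set0Pn[p0 p0A]; case: (arg_minnP y p0A) => p pA min_p.
by exists p => //; rewrite -sum_nat_const; exact: leq_sum.
Qed.

(* At a point where the sum of the normalised values b_i/X_i, X_i the sum of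
   b_i, is at most its average 3/#|A|, AM-GM bounds their product. *)
Lemma Hoelder3 (J : finType) (A : {set J}) (b1 b2 b3 : J -> nat) m :
  (forall p, p \in A -> m <= b1 p * b2 p * b3 p) ->
  #|A| ^ 3 * m <=
    (\sum_(p in A) b1 p) * (\sum_(p in A) b2 p) * (\sum_(p in A) b3 p).
Proof.
move=> m_le; have [->|A0] := eqVneq A set0; first by rewrite cards0.
set X1 := \sum_(p in A) b1 p; set X2 := \sum_(p in A) b2 p.
set X3 := \sum_(p in A) b3 p.
(* The sum of the normalised values, with denominators cleared by [X1 * X2 * X3]. *)
pose y p := b1 p * (X2 * X3) + b2 p * (X1 * X3) + b3 p * (X1 * X2).
have [p pA yp] := exists_le_average y A0.
have yE : \sum_(q in A) y q = 3 * (X1 * X2 * X3).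
  by rewrite /y !big_split /= -!big_distrl /= -/X1 -/X2 -/X3; lia.
rewrite yE in yp.
have AG := nat_AGM3 (b1 p * (X2 * X3)) (b2 p * (X1 * X3)) (b3 p * (X1 * X2)).
have [P0|P0] := posnP (X1 * X2 * X3).
  case: m m_le => [|m] m_le; first by rewrite muln0.
  have [q qA] : exists q, q \in A by apply/set0Pn.
  have pos b : (forall q, q \in A -> 0 < b q) -> 0 < \sum_(q in A) b q.
    by move=> b0; rewrite (bigD1 q) //= addn_gt0 b0.
  suff : 0 < X1 * X2 * X3 by rewrite P0.
  by rewrite !muln_gt0 !pos // => r /m_le; case: (b1 r) (b2 r) (b3 r) => [|?] [|?] [|?]; lia.
set P := X1 * X2 * X3 in P0 yp AG *.
have H1 : 27 * (m * P ^ 2) <= y p ^ 3.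
  apply: leq_trans AG; rewrite leq_mul2l /=.
  apply: (@leq_trans (b1 p * b2 p * b3 p * P ^ 2)).
    by rewrite leq_mul2r m_le ?orbT.
  by rewrite /P; lia.
have H2 : (#|A| * y p) ^ 3 <= (3 * P) ^ 3 by rewrite leq_exp2r.
have H3 : 27 * (P ^ 2) * (#|A| ^ 3 * m) <= 27 * (P ^ 2) * P.
  apply: leq_trans (_ : #|A| ^ 3 * y p ^ 3 <= _).
    by rewrite [X in X <= _](_ : _ = #|A| ^ 3 * (27 * (m * P ^ 2))) ?leq_mul2l ?H1 ?orbT //; lia.
  by rewrite -expnMn (leq_trans H2) // expnMn; lia.
by move: H3; rewrite leq_pmul2l // muln_gt0 expn_gt0 P0.
Qed.

(** * Handicaps and the combinatorial bound *)

Section Handicaps.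
Variables (J T : finType) (l : 'I_3 -> J -> T).
Implicit Types (A S : {set J}) (beta : J -> nat).

(** Each point keeps one chosen line per index: a point lying on [l i p] but assigned another i-th
    line is left out. *)
Definition fiber A i p := [set q in A | l i q == l i p].

(* [ord] is the order of vanishing at each point, and [g] the exponent along the
   i-th line through p of a lowest-order monomial at p: on that line, the
   corresponding derivative vanishes at q to order ord q + g - ord p. *)
Definition vanishing_property := forall A D (b : J -> 'I_3 -> nat),
  \sum_(p in A) \prod_i b p i < 'C(D + 3, 3) ->
  exists ord : J -> nat, forall p, p \in A -> exists i g,
    b p i <= g /\ \sum_(q in fiber A i p) (ord q + g - ord p) <= D.

Definition share D A beta p i := level D beta (fiber A i p) - beta p.

Lemma mem_fiber A i p : p \in A -> p \in fiber A i p.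
Proof. by move=> pA; rewrite inE pA eqxx. Qed.

Lemma fiber_neq0 A i p : p \in A -> fiber A i p != set0.
Proof. by move=> pA; apply/set0Pn; exists p; exact: mem_fiber. Qed.

Lemma exists_large_share D A beta lam : vanishing_property -> A != set0 ->
  #|A| * lam < 'C(D + 3, 3) ->
  exists2 p, p \in A & lam < \prod_i share D A beta p i.
Proof.
move=> vanish /set0Pn[p0 p0A] lt_lam; apply/exists_inP; apply: contraLR lt_lam.
move=> /exists_inPn small; rewrite -leqNgt leqNgt; apply/negP => lt_lam.
have : \sum_(p in A) \prod_i share D A beta p i < 'C(D + 3, 3).
  apply: leq_ltn_trans lt_lam; rewrite -sum_nat_const.
  by apply: leq_sum => p /small; rewrite -leqNgt.
move=> /vanish[ord ordP].
(* By minimality [beta p - beta q] is at most [ord q - ord p], so the orders along the line dominate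
   the volume at height [g + beta p], which exceeds [D]. *)
case: (arg_minnP (fun p => ord p + beta p) p0A) => p pA min_p.
have [i [g [le_g]]] := ordP p pA.
apply/negP; rewrite -ltnNge.
have : level D beta (fiber A i p) <= g + beta p by rewrite addnC -leq_subLR.
rewrite leqNgt levelP ?fiber_neq0 // -ltnNge => /leq_trans; apply.
apply: leq_sum => q; rewrite inE => /andP[qA _]; have := min_p q qA; lia.
Qed.

Lemma sum_share_lines D A beta i :
  \sum_(p in A) (share D A beta p i).+1 <= #|l i @: A| * (D + 2 * #|A|).
Proof.
rewrite (partition_big_imset (l i)) /= -sum_nat_const.
apply: leq_sum => _ /imsetP[p pA ->].
rewrite (eq_bigl (fun q => q \in fiber A i p)) => [|q]; last by rewrite inE.
rewrite (eq_bigr (fun q => (level D beta (fiber A i p) - beta q).+1)).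
  apply: leq_trans (sum_share_le D beta (fiber_neq0 i pA)) _.
  rewrite leq_add2l leq_mul2l subset_leq_card ?orbT //.
  by apply/subsetP=> q; rewrite inE => /andP[].
move=> q; rewrite inE => /andP[qA /eqP lq]; rewrite /share.
by rewrite (_ : fiber A i q = fiber A i p) // /fiber lq.
Qed.

(** The successors absorb the unit that a share may lose when the handicap of its own point is
    raised. *)
Definition admissible D A lam beta :=
  forall p, p \in A -> 0 < beta p -> lam < \prod_i (share D A beta p i).+1.

(** Levels only grow with the handicap, so the other points keep at least their shares. *)
Lemma admissible_step D A lam beta p0 : p0 \in A ->
  admissible D A lam beta -> lam < \prod_i share D A beta p0 i ->
  admissible D A lam (fun p => beta p + (p == p0)).
Proof.
move=> p0A adm lam_p0 p pA beta_p.
have lev i : level D beta (fiber A i p) <= level D (fun p => beta p + (p == p0)) (fiber A i p).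
  by apply: level_anti; [exact: fiber_neq0 | move=> q; exact: leq_addr].
have [pp0|pp0] := eqVneq p p0.
  apply: leq_trans lam_p0 _; rewrite -pp0; apply: leq_prod => i _.
  by rewrite /share eqxx; have := lev i; rewrite -pp0; lia.
apply: leq_trans (adm p pA _) _; first by move: beta_p; rewrite (negbTE pp0) addn0.
apply: leq_prod => i _; rewrite /share (negbTE pp0) addn0 ltnS.
exact/leq_sub2r/lev.
Qed.

Lemma share_le D A beta p i : p \in A -> share D A beta p i <= D.+1.
Proof.
move=> pA; rewrite leqNgt ltn_subRL levelP ?fiber_neq0 // -ltnNge.
by rewrite /volume (bigD1 p) ?mem_fiber //=; lia.
Qed.

(** If the i-th share of a raised [p] were zero, the product would be at most [D.+2 ^ 2], hence at
    most [lam]. So it is positive and [share_gap] applies. *)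
Lemma admissible_adjacent D A lam beta p q i : D.+2 ^ 2 <= lam ->
  admissible D A lam beta -> p \in A -> q \in A -> l i p = l i q ->
  beta p <= beta q + D.
Proof.
move=> Dlam adm pA qA lpq; have [->//|beta_p] := posnP (beta p).
have [share0|share_gt0] := posnP (share D A beta p i).
  have := adm p pA beta_p; rewrite (bigD1 i) //= share0 mul1n ltnNge.
  case/negP; apply: leq_trans Dlam.
  apply: (@leq_trans (\prod_(j < 3 | j != i) D.+2)).
    by apply: leq_prod => j _; rewrite ltnS share_le.
  by rewrite prod_nat_const (_ : #|_| = 2) // cardC1 card_ord.
by apply: share_gap share_gt0; rewrite !inE ?pA ?qA ?lpq eqxx.
Qed.

(** Connectivity, phrased by cuts, of the graph joining points that share their i-th line for some
    [i]. *)
Definition linked A := forall S, S \subset A -> S != set0 -> S != A ->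
  exists p q i, [/\ p \in A :\: S, q \in S & l i p = l i q].

Lemma admissible_bounded D A lam beta p0 : D.+2 ^ 2 <= lam -> linked A ->
  admissible D A lam beta -> p0 \in A -> beta p0 = 0 ->
  forall p, p \in A -> beta p <= #|A| * D.
Proof.
move=> Dlam link adm p0A beta0.
(* A link out of [S k] costs at most [D], so each step from [k] to [k.+1] gains a point until [A] is
   exhausted. *)
pose S k := [set q in A | beta q <= k * D].
have SA k : S k \subset A by apply/subsetP => q; rewrite inE => /andP[].
have S_mono k : S k \subset S k.+1.
  by apply/subsetP => q; rewrite !inE => /andP[-> /leq_trans]; apply; rewrite leq_mul2r leqnSn orbT.
have grow k : (S k == A) || (k < #|S k|).
  elim: k => [|k /orP[/eqP Sk|IH]].
  - by apply/orP; right; rewrite card_gt0; apply/set0Pn; exists p0; rewrite inE p0A beta0.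
  - by rewrite eqEsubset SA -{1}Sk S_mono.
  have [//|SkA] /= := eqVneq (S k.+1) A.
  have Sk0 : S k != set0 by rewrite -card_gt0 (leq_ltn_trans _ IH).
  have SkA' : S k != A.
    by apply: contra SkA => /eqP E; rewrite eqEsubset SA -{1}E S_mono.
  have [p [q [i [pS qS lpq]]]] := link _ (SA k) Sk0 SkA'.
  apply: leq_ltn_trans IH _; apply: proper_card; apply/properP; split=> //.
  move: pS; rewrite in_setD => /andP[pS pA]; exists p => //.
  move: (qS); rewrite !inE pA /= => /andP[qA beta_q].
  by have := admissible_adjacent Dlam adm pA qA lpq; rewrite mulSn; lia.
move=> p pA; have /orP[/eqP SA'|] := grow #|A|.
  by move: pA; rewrite -{1}SA' inE => /andP[].
by rewrite ltnNge subset_leq_card.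
Qed.

Lemma linked_bound A : vanishing_property -> linked A ->
  #|A| ^ 2 <= 10 * \prod_i #|l i @: A|.
Proof.
move=> vanish link; have [->|A0] := eqVneq A set0; first by rewrite cards0.
set n := #|A|; have n_gt0 : 0 < n by rewrite card_gt0.
(* [lam] is [D ^ 3 / (6 * n)], just below what the binomial count permits; the factor 12 lets it
   dominate [D.+2 ^ 2] from [n = 1] on. *)
pose D := 12 * n; pose lam := 288 * n ^ 2.
have Dlam : D.+2 ^ 2 <= lam by rewrite /D /lam; nia.
have lamD : n * lam < 'C(D + 3, 3).
  have := bin_ffact (D + 3) 3; rewrite !ffactnS ffactn0 addnS /= addnS /= addn1 /=.
  by rewrite (_ : 3`! = 6) // /D /lam; nia.
have [//|large] := leqP; exfalso.
(* If every point were raised, Hoelder with budget [D + 2 * n = 14 * n] per line would bound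
   [288 * n ^ 2] by [14 ^ 3 = 2744] times the product of the line counts; as 2744 / 288 < 10, this
   contradicts [large]. *)
have zero beta : admissible D A lam beta -> exists2 p, p \in A & beta p = 0.
  move=> adm; suff /exists_inP[p pA /eqP p0] : [exists p in A, beta p == 0] by exists p.
  apply: contraLR large => /exists_inPn nz.
  rewrite -leqNgt.
  have Hoelder := @Hoelder3 _ A (fun p => (share D A beta p ord0).+1)
    (fun p => (share D A beta p (lift ord0 ord0)).+1)
    (fun p => (share D A beta p (lift ord0 (lift ord0 ord0))).+1) lam.+1.
  have /Hoelder{Hoelder} le_prod p : p \in A -> lam.+1 <=
      (share D A beta p ord0).+1 * (share D A beta p (lift ord0 ord0)).+1 *
      (share D A beta p (lift ord0 (lift ord0 ord0))).+1.
    move=> pA; have := adm p pA; rewrite lt0n => /(_ (nz p pA)).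
    by rewrite !big_ord_recl big_ord0 muln1 mulnA.
  pose X i := \sum_(p in A) (share D A beta p i).+1.
  have X_le i : X i <= #|l i @: A| * (14 * n).
    by rewrite (_ : 14 * n = D + 2 * #|A|) ?sum_share_lines // /D -/n; lia.
  have {}le_prod := leq_trans le_prod (leq_mul (leq_mul (X_le _) (X_le _)) (X_le _)).
  rewrite /lam -/n in le_prod.
  set L := \prod_i _; have {le_prod} : n ^ 3 * (288 * n ^ 2).+1 <= n ^ 3 * (2744 * L).
    apply: leq_trans le_prod _; rewrite /L !big_ord_recl big_ord0 /=.
    by rewrite muln1; lia.
  rewrite leq_pmul2l ?expn_gt0 ?n_gt0 // -/n; move: (n ^ 2); clearbody L; clear; lia.
have unbounded k : exists2 beta, admissible D A lam beta & k <= \sum_(p in A) beta p.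
  elim: k => [|k [beta adm k_le]]; first by exists (fun=> 0).
  have [p0 p0A lam_p0] := exists_large_share beta vanish A0 lamD.
  exists (fun p => beta p + (p == p0)); first exact: admissible_step.
  by rewrite big_split -addn1 leq_add //= (bigD1 p0) //= eqxx.
(* One more than the total that [admissible_bounded] allows once some handicap is zero. *)
have [beta adm] := unbounded (n * (n * D)).+1.
have [p0 p0A beta0] := zero _ adm.
rewrite ltnNge -[n * _]sum_nat_const; case/negP; apply: leq_sum.
exact: admissible_bounded Dlam link adm p0A beta0.
Qed.

(** By AM-GM the cross term [2 * (a * b)] is at most [10 * (x + y)], where [x] and [y] are two mixed
    terms of the expanded right side. *)
Lemma superadditive_bound a b s1 s2 s3 t1 t2 t3 :
  a ^ 2 <= 10 * (s1 * s2 * s3) -> b ^ 2 <= 10 * (t1 * t2 * t3) ->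
  (a + b) ^ 2 <= 10 * ((s1 + t1) * (s2 + t2) * (s3 + t3)).
Proof.
move=> a_le b_le; pose x := s1 * s2 * t3; pose y := t1 * t2 * s3.
have ab_le : (2 * (a * b)) ^ 2 <= (10 * (x + y)) ^ 2.
  apply: leq_trans (_ : 4 * ((10 * (s1 * s2 * s3)) * (10 * (t1 * t2 * t3))) <= _).
    by rewrite !expnMn leq_mul2l leq_mul.
  rewrite (_ : 4 * _ = 100 * (4 * (x * y))) ?expnMn; last by rewrite /x /y; lia.
  by rewrite leq_mul2l nat_AGM2.
rewrite leq_exp2r // in ab_le.
apply: (@leq_trans (10 * (s1 * s2 * s3) + 10 * (t1 * t2 * t3) + 10 * (x + y))).
  by rewrite sqrnD mulnDr; lia.
by rewrite /x /y; lia.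
Qed.

Theorem vanishing_bound A :
  vanishing_property -> #|A| ^ 2 <= 10 * \prod_i #|l i @: A|.
Proof.
move=> vanish; have [k] := ubnP #|A|; elim: k A => // k IH A Ak.
(* No i-th line is common to [S] and its complement in [A], so line counts add up and the two
   induction hypotheses combine. *)
pose split S := [&& S \subset A, S != set0, S != A &
  [forall p in A :\: S, forall q in S, forall i, l i p != l i q]].
have [/existsP[S /and4P[SA S0 SnA /forall_inP sep]]|/existsPn unsplit] :=
    boolP [exists S, split S]; last first.
  apply: linked_bound => // S SA S0 SnA.
  have := unsplit S; rewrite /split SA S0 SnA /= => /forall_inPn[p pS].
  move=> /forall_inPn[q qS] /forallPn[i]; rewrite negbK => /eqP lpq.
  by exists p, q, i.
have AE : A = S :|: (A :\: S) by rewrite -{1}(setID A S) (setIidPr SA).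
have cardA : #|A| = #|S| + #|A :\: S|.
  by rewrite -(cardsID S A) (setIidPr SA).
have card_im i : #|l i @: A| = #|l i @: S| + #|l i @: (A :\: S)|.
  rewrite [in LHS]AE imsetU cardsU (_ : _ :&: _ = set0) ?cards0 ?subn0 //.
  apply/setP => t; rewrite !inE; apply/negP => /andP[/imsetP[q qS ->] /imsetP[p pS]].
  by move: (sep p pS) => /forall_inP/(_ q qS)/forallP/(_ i) /eqP + /esym.
have lt_S : #|S| < #|A| by rewrite proper_card // properEneq SnA.
have lt_AS : #|A :\: S| < #|A| by rewrite cardA -{1}[#|_ :\: _|]add0n ltn_add2r card_gt0.
have IHS := IH S (leq_trans lt_S Ak); have IHAS := IH (A :\: S) (leq_trans lt_AS Ak).
move: IHS IHAS; rewrite cardA !big_ord_recl !big_ord0 !muln1 !card_im !mulnA.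
by rewrite -!(mulnA 10); exact: superadditive_bound.
Qed.

End Handicaps.

Local Open Scope ring_scope.

(** * Vanishing orders of polynomials *)

Lemma underdetermined_system (F : fieldType) (K E : finType) (a : K -> E -> F) :
  (#|E| < #|K|)%N ->
  exists c : K -> F,
    (exists k, c k != 0) /\ forall e, \sum_k c k * a k e = 0.
Proof.
move=> EK; pose M : 'M[F]_(#|K|, #|E|) := \matrix_(i, j) a (enum_val i) (enum_val j).
have kerM0 : kermx M != 0.
  rewrite -mxrank_eq0 mxrank_ker subn_eq0 -ltnNge.
  exact: leq_ltn_trans (rank_leq_col M) EK.
have [r v0] : exists r, row r (kermx M) != 0.
  apply/existsP; apply: contraR kerM0 => /existsPn v0.
  by apply/eqP/row_matrixP => r; rewrite row0; apply/eqP/negbNE/v0.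
have vM : row r (kermx M) *m M = 0 by apply/sub_kermxP; exact: row_sub.
move: (row r _) v0 vM => v v0 vM; exists (fun k => v 0 (enum_rank k)); split.
  by have /rV0Pn[j vj] := v0; exists (enum_val j); rewrite enum_valK.
move=> e; have /matrixP/(_ 0 (enum_rank e)) := vM; rewrite !mxE; apply: etrans.
rewrite [RHS](reindex enum_rank); last exact/onW_bij/enum_rank_bij.
by apply: eq_bigr => k _; rewrite !mxE !enum_rankK.
Qed.

(** Powers of distinct monic linear factors are coprime, so their product divides [g]. *)
Lemma sum_root_mult_lt_size (F : fieldType) (Q : finType) (P : pred Q)
    (t : Q -> F) (e : Q -> nat) (g : {poly F}) :
  {in P &, injective t} ->
  (forall q, P q -> ('X - (t q)%:P) ^+ e q %| g) -> g != 0 ->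
  (\sum_(q | P q) e q < size g)%N.
Proof.
move=> t_inj dvd_g g0.
suff [dvdP sizeP] : \prod_(q | P q) ('X - (t q)%:P) ^+ e q %| g /\
    size (\prod_(q | P q) ('X - (t q)%:P) ^+ e q) = (\sum_(q | P q) e q).+1.
  by rewrite -sizeP dvdp_leq.
split; last first.
  elim/big_rec2: _ => [|q m p Pq IH]; first by rewrite size_poly1.
  have monicX : ('X - (t q)%:P) ^+ e q \is monic by exact/monic_exp/monicXsubC.
  have p0 : p != 0 by rewrite -size_poly_eq0 IH.
  by rewrite size_monicM // size_exp_XsubC IH addSn addnS.
rewrite -big_filter.
have : all P (filter P (index_enum Q)) by exact: filter_all.
have : uniq (filter P (index_enum Q)) by rewrite filter_uniq ?index_enum_uniq.
elim: (filter _ _) => [|q s IH] /=; first by rewrite big_nil dvd1p.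
move=> /andP[qs us] /andP[Pq Ps]; rewrite big_cons Gauss_dvdp ?dvd_g ?IH //.
rewrite coprimep_expl // big_seq; elim/big_rec: _ => [|r p rs IHp].
  exact: coprimep1.
rewrite coprimepMr IHp andbT coprimep_expr // coprimep_XsubC root_XsubC.
apply: contra qs => /eqP tqr; rewrite -(t_inj r q _ _ tqr) //.
exact: (allP Ps).
Qed.

(** * Order at the origin and affine substitution *)

Section MPoly.
Variables (n : nat).

Lemma mmap_comp_mpoly (R S : comNzRingType) (f : {rmorphism R -> S}) (h : 'I_n -> S)
    (lq : n.-tuple {mpoly R[n]}) (p : {mpoly R[n]}) :
  mmap f h (p \mPo lq) = mmap f (fun j => mmap f h (tnth lq j)) p.
Proof.
rewrite comp_mpolyEX raddf_sum; apply: eq_bigr => m _ /=.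
rewrite mmapZ; congr (_ * _); rewrite comp_mpolyX rmorph_prod /mmap1.
by apply: eq_bigr => i _; rewrite rmorphXn.
Qed.

Variable (R : idomainType).
Implicit Types (f g : {mpoly R[n]}) (m : 'X_{1..n}) (k : nat).

(** Order of vanishing at the origin, read off the coefficients and so meaningful in every
    characteristic; other points are first translated to the origin. *)
Definition vanish_order_ge k f := all (fun m => k <= mdeg m)%N (msupp f).

Lemma vanish_order_geP k f :
  reflect (forall m, (mdeg m < k)%N -> f@_m = 0) (vanish_order_ge k f).
Proof.
apply: (iffP allP) => [vf m mk|vf m].
  by apply: memN_msupp_eq0; apply/negP => /vf; rewrite leqNgt mk.
by rewrite leqNgt mcoeff_msupp; apply: contra => /vf ->.
Qed.

Lemma vanish_order_ge_sum (I : Type) (r : seq I) (P : pred I) (f : I -> {mpoly R[n]}) k :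
  (forall i, P i -> vanish_order_ge k (f i)) ->
  vanish_order_ge k (\sum_(i <- r | P i) f i).
Proof.
move=> vf; apply/vanish_order_geP => m mk; rewrite raddf_sum big1 // => i /vf.
by move=> /vanish_order_geP; exact.
Qed.

Lemma vanish_order_geZ c k f : vanish_order_ge k f -> vanish_order_ge k (c *: f).
Proof.
move=> /vanish_order_geP vf; apply/vanish_order_geP => m mk.
by rewrite mcoeffZ vf ?mulr0.
Qed.

Lemma vanish_order_geM k l f g : vanish_order_ge k f -> vanish_order_ge l g ->
  vanish_order_ge (k + l) (f * g).
Proof.
move=> /vanish_order_geP vf /vanish_order_geP vg; apply/vanish_order_geP => m mk.
rewrite mcoeffM big1 // => -[[m1 ?] [m2 ?]] /= /eqP mE.
have [/vf->|le1] := ltnP (mdeg m1) k; first by rewrite mul0r.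
rewrite vg ?mulr0 //; move: mk; rewrite mE mdegD; lia.
Qed.

Lemma vanish_order_geX k l f : vanish_order_ge k f -> vanish_order_ge (l * k) (f ^+ l).
Proof.
move=> vf; elim: l => [|l IH]; last by rewrite exprS mulSn vanish_order_geM.
by apply/vanish_order_geP.
Qed.

Lemma vanish_order_ge_leq k l f : (k <= l)%N ->
  vanish_order_ge l f -> vanish_order_ge k f.
Proof.
move=> kl /vanish_order_geP vf; apply/vanish_order_geP => m mk.
exact/vf/(leq_trans mk).
Qed.

(** The map [x |-> c + x *m M] on row vectors: the i-th axis goes to the line through [c] along row
    [i] of [M]. *)
Definition affine_tuple (c : 'rV[R]_n) (M : 'M[R]_n) : n.-tuple {mpoly R[n]} :=
  [tuple (c 0 j)%:MP + \sum_i M i j *: 'X_i | j < n].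

Lemma comp_affine_affine f c M c' M' :
  f \mPo affine_tuple c M \mPo affine_tuple c' M' =
  f \mPo affine_tuple (c + c' *m M) (M' *m M).
Proof.
rewrite /comp_mpoly mmap_comp_mpoly; apply: eq_bigr => m _; congr (_ * _).
apply: mmap1_eq => j; rewrite !tnth_mktuple raddfD raddf_sum /= mmapC !mxE raddfD.
rewrite -addrA; congr (_ + _).
under eq_bigr => i _.
  rewrite mmapZ mmapX mmap1U tnth_mktuple mul_mpolyC scalerDr scaler_sumr; over.
rewrite big_split raddf_sum; congr (_ + _).
  by apply: eq_bigr => i _; rewrite -mul_mpolyC -mpolyCM mulrC.
rewrite exchange_big; apply: eq_bigr => i _ /=; rewrite mxE scaler_suml.
by apply: eq_bigr => k _; rewrite scalerA mulrC.
Qed.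

Lemma comp_affine_id f : f \mPo affine_tuple 0 1%:M = f.
Proof.
rewrite -[RHS]comp_mpoly_id /comp_mpoly; apply: eq_bigr => m _; congr (_ * _).
apply: mmap1_eq => j; rewrite !tnth_mktuple mxE add0r (bigD1 j) //= big1 => [|i ij].
  by rewrite addr0 mxE eqxx scale1r.
by rewrite mxE (negbTE ij) scale0r.
Qed.

(** Linear forms have no constant term, so each monomial turns into a polynomial vanishing at least
    to its degree. *)
Lemma vanish_order_ge_comp_linear k f M :
  vanish_order_ge k f -> vanish_order_ge k (f \mPo affine_tuple 0 M).
Proof.
move=> /allP vf; rewrite comp_mpolyEX big_seq; apply: vanish_order_ge_sum => m /vf km.
apply/vanish_order_geZ/(vanish_order_ge_leq km); rewrite comp_mpolyX mdegE.
elim/big_rec2: _ => [|i q l _ vq]; first exact/vanish_order_geP.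
apply: vanish_order_geM vq; rewrite -[X in vanish_order_ge X _]muln1; apply: vanish_order_geX.
rewrite tnth_mktuple mxE add0r; apply: vanish_order_ge_sum => j _.
apply: vanish_order_geZ; apply/vanish_order_geP => u; rewrite ltnS leqn0 mdeg_eq0.
by move=> /eqP ->; rewrite mcoeffX -mdeg_eq0 mdeg1.
Qed.

Lemma msizeM_le_pred f g : (msize (f * g) <= (msize f + msize g).-1)%N.
Proof.
have [->|f0] := eqVneq f 0; first by rewrite mul0r msize0.
have [->|g0] := eqVneq g 0; first by rewrite mulr0 msize0.
by rewrite msizeM.
Qed.

Lemma msize_comp_affine f c M : (msize (f \mPo affine_tuple c M) <= msize f)%N.
Proof.
rewrite comp_mpolyEX big_seq.
have size0 : (msize (0 : {mpoly R[n]}) <= msize f)%N by rewrite msize0.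
apply: (big_ind (fun g => (msize g <= msize f)%N)) => //.
  by move=> g h gf hf; rewrite (leq_trans (msizeD_le _ _)) // geq_max gf.
move=> m mf; apply: leq_trans (msizeZ_le _ _) _.
apply: leq_trans (msize_mdeg_lt mf); rewrite comp_mpolyX mdegE.
elim/big_rec2: _ => [|i q l _ IH]; first by rewrite msize1.
apply: leq_trans (msizeM_le_pred _ _) _.
have linear_size : (msize (tnth (affine_tuple c M) i) <= 2)%N.
  rewrite tnth_mktuple (leq_trans (msizeD_le _ _)) // geq_max msizeC.
  rewrite (leq_trans (leq_b1 _)) //=.
  apply: (big_ind (fun g => (msize g <= 2)%N)); first by rewrite msize0.
    by move=> g h gf hf; rewrite (leq_trans (msizeD_le _ _)) // geq_max gf.
  by move=> j _; rewrite (leq_trans (msizeZ_le _ _)) // msizeX mdeg1.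
suff : (msize (tnth (affine_tuple c M) i ^+ m i) <= (m i).+1)%N by lia.
elim: (m i) => [|d IHd]; first by rewrite msize1.
by rewrite exprS (leq_trans (msizeM_le_pred _ _)) //; lia.
Qed.

End MPoly.

(** * Restriction to a coordinate axis *)

Section Slices.
Variables (n : nat) (F : fieldType) (i : 'I_n).
Implicit Types (f h : {mpoly F[n]}) (m : 'X_{1..n}) (a : {poly F}).

Definition drop_var m : 'X_{1..n} := [multinom (if j == i then 0%N else m j) | j < n].

Lemma mdeg_drop_var m : mdeg m = (m i + mdeg (drop_var m))%N.
Proof.
rewrite !mdegE (bigD1 i) //= [in RHS](bigD1 i) //= mnmE eqxx add0n; congr addn.
by apply: eq_bigr => j /negbTE ji; rewrite mnmE ji.
Qed.

Definition subst_var a : {mpoly F[n]} -> {mpoly {poly F}[n]} :=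
  mmap (@mpolyC n {poly F} \o polyC) (fun j => if j == i then a%:MP else 'X_j).

(* The coefficient in [f] of the monomial [m] stripped of its i-th variable, as a
   polynomial in that variable, evaluated at [a]. *)
Definition slice a m f : {poly F} := (subst_var a f)@_(drop_var m).

Lemma sliceE a m f : slice a m f =
  \sum_(u <- msupp f | drop_var u == drop_var m) f@_u *: a ^+ u i.
Proof.
rewrite /slice /subst_var /mmap raddf_sum [RHS]big_mkcond; apply: eq_bigr => u _ /=.
have -> : mmap1 (fun j => if j == i then a%:MP else 'X_j) u =
    (a ^+ u i)%:MP * 'X_[drop_var u].
  rewrite mpolyXE_id /mmap1 (bigD1 i) //= eqxx [in RHS](bigD1 i) //= mnmE eqxx.
  rewrite expr0 mul1r rmorphXn; congr (_ * _).
  by apply: eq_bigr => j /negbTE ji; rewrite mnmE ji.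
rewrite mulrA -mpolyCM mcoeffCM mcoeffX mul_polyC.
by case: eqP => _; rewrite ?mulr1 ?mulr0.
Qed.

Lemma slice_comp_translate t m f :
  slice 'X m (f \mPo affine_tuple (t *: delta_mx 0 i) 1%:M) = slice ('X + t%:P) m f.
Proof.
congr (mcoeff _ _); rewrite /subst_var.
rewrite (@mmap_comp_mpoly _ _ _ (@mpolyC n {poly F} \o polyC)).
apply: eq_bigr => u _; congr (_ * _); apply: mmap1_eq => j.
rewrite tnth_mktuple raddfD raddf_sum /= mmapC !mxE eqxx /=.
rewrite (bigD1 j) //= big1 => [|k /negbTE kj].
  rewrite addr0 mmapZ mmapX mmap1U mxE eqxx /= !rmorph1 mul1r.
  case: (j == i); first by rewrite mulr1 -mpolyCD addrC.
  by rewrite mulr0 !raddf0 add0r.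
by rewrite mmapZ mxE kj /= !raddf0 mul0r.
Qed.

(** A monomial of [f] agreeing with [m] off the i-th variable has degree at least [k], which bounds
    its i-th exponent from below. *)
Lemma slice_dvdp k c m f : vanish_order_ge k f ->
  ('X - c%:P) ^+ (k + m i - mdeg m) %| slice ('X - c%:P) m f.
Proof.
move=> /allP vf; rewrite sliceE big_seq_cond.
elim/big_rec: _ => [|u p /andP[/vf ku /eqP um] IH]; first exact: dvdp0.
rewrite dvdp_addl // -mul_polyC dvdp_mull // dvdp_exp2l //.
by move: ku; rewrite mdeg_drop_var um [mdeg m]mdeg_drop_var; lia.
Qed.

Lemma coef_slice m f : (slice 'X m f)`_(m i) = f@_m.
Proof.
rewrite sliceE coef_sum; have [mf|mf] := boolP (m \in msupp f); last first.
  rewrite (memN_msupp_eq0 mf) big_seq_cond big1 // => u /andP[uf /eqP um].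
  rewrite coefZ coefXn; case: eqP => [mu|]; last by rewrite mulr0.
  case/negP: mf; rewrite (_ : m = u) //; apply/mnmP => j.
  by move/mnmP/(_ j): um; rewrite !mnmE; case: eqP => [->|].
rewrite big_mkcond (bigD1_seq m) ?msupp_uniq //= eqxx coefZ coefXn eqxx mulr1.
rewrite big1 ?addr0 // => u u_m; case: eqP => // um.
rewrite coefZ coefXn; case: eqP => [mu|]; last by rewrite mulr0.
case/eqP: u_m; apply/mnmP => j.
by move/mnmP/(_ j): um; rewrite !mnmE; case: eqP => [->|].
Qed.

Lemma size_slice m f : (size (slice 'X m f) <= msize f)%N.
Proof.
rewrite sliceE big_seq_cond.
apply: (big_ind (fun p : {poly F} => (size p <= msize f)%N)); first by rewrite size_poly0.
  by move=> p q pf qf; rewrite (leq_trans (size_polyD _ _)) // geq_max pf.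
move=> u /andP[uf _]; apply: leq_trans (size_scale_leq _ _) _.
rewrite size_polyXn (leq_ltn_trans _ (msize_mdeg_lt uf)) //.
by rewrite mdeg_drop_var leq_addr.
Qed.

(** [slice 'X m h] is the restriction to the i-th axis of the Hasse derivative of [h] with exponents
    [drop_var m]. It is nonzero by [coef_slice], and its roots [t q] are counted with
    multiplicity. *)
Lemma line_order_sum (h : {mpoly F[n]}) m (D : nat) (Q : finType) (P : pred Q)
    (t : Q -> F) (k : Q -> nat) :
  h@_m != 0 -> (msize h <= D.+1)%N -> {in P &, injective t} ->
  (forall q, P q ->
    vanish_order_ge (k q) (h \mPo affine_tuple (t q *: delta_mx 0 i) 1%:M)) ->
  (\sum_(q | P q) (k q + m i - mdeg m) <= D)%N.
Proof.
move=> hm hD t_inj vh; rewrite -ltnS; apply: leq_trans hD.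
apply: leq_trans (size_slice m h); apply: (sum_root_mult_lt_size t_inj).
  move=> q /vh/(slice_dvdp (t q) m); set h' := h \mPo _.
  (* Translating [h'] back by [- t q] along the axis recovers [h]. *)
  suff -> : slice ('X - (t q)%:P) m h' = slice 'X m h by [].
  rewrite -[RHS](congr1 (slice 'X m) (comp_affine_id h)).
  have -> : h \mPo affine_tuple 0 1%:M =
      h' \mPo affine_tuple ((- t q) *: delta_mx 0 i) 1%:M.
    by rewrite comp_affine_affine !mulmx1 scaleNr addrN.
  by rewrite slice_comp_translate polyCN.
by apply: contra_neq hm => g0; rewrite -coef_slice g0 coef0.
Qed.

End Slices.

(** * Parameter counting and the vanishing property *)

Lemma card_ord_lt_le (k b : nat) : (#|[pred x : 'I_k | (x < b)%N]| <= b)%N.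
Proof.
rewrite cardE -(size_map val) -[X in (_ <= X)%N](size_iota 0).
apply: uniq_leq_size; first by rewrite map_inj_uniq ?enum_uniq //; exact: val_inj.
by move=> _ /mapP[x + ->]; rewrite mem_enum mem_iota.
Qed.

Lemma exists_vanishing_mpoly (n : nat) (F : fieldType) (J : finType) (A : {set J})
    (D : nat) (c : J -> 'rV[F]_n) (E : J -> 'M[F]_n) (b : J -> 'I_n -> nat) :
  (\sum_(p in A) \prod_i b p i < 'C(D + n, n))%N ->
  exists f : {mpoly F[n]}, [/\ f != 0, (msize f <= D.+1)%N &
    forall p (m : 'X_{1..n}), p \in A -> (forall i, m i < b p i)%N ->
      (f \mPo affine_tuple (c p) (E p))@_m = 0].
Proof.
move=> few; pose K : finType := {t : n.-tuple 'I_D.+1 | (\sum_(i <- t) i <= D)%N}.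
pose mon (k : K) : 'X_{1..n} := [multinom (tnth (val k) i : nat) | i < n].
(* Only exponents up to [D] need a condition: affine substitution does not raise the degree, so
   higher coefficients vanish anyway. *)
pose C : finType := {q : J * {ffun 'I_n -> 'I_D.+1} |
  (q.1 \in A) && [forall i, (q.2 i < b q.1 i)%N]}.
pose a (k : K) (e : C) : F :=
  ('X_[mon k] \mPo affine_tuple (c (val e).1) (E (val e).1))@_[multinom (val e).2 i : nat | i < n].
have few_conditions : (#|C| < #|K|)%N.
  rewrite [#|K|]card_sig -[X in (_ < X)%N]cardsE card_partial_ord_partitions addnC.
  apply: leq_ltn_trans few; rewrite card_sig -sum1_card.
  rewrite -(pair_big_dep (mem A) (fun p (g : {ffun 'I_n -> 'I_D.+1}) =>
     [forall i, (g i < b p i)%N]) (fun _ _ => 1%N)) /=.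
  apply: leq_sum => p _; rewrite sum1_card.
  rewrite (eq_card (B := family (fun i => [pred x : 'I_D.+1 | (x < b p i)%N]))); last first.
    by move=> g; rewrite !inE.
  rewrite card_family foldrE big_map big_enum /=.
  by apply: leq_prod => i _; exact: card_ord_lt_le.
have [x [[k0 xk0] x_sol]] := underdetermined_system a few_conditions.
have mon_inj : injective mon.
  move=> k k' /mnmP kk'; apply/val_inj/eq_from_tnth => i.
  by have := kk' i; rewrite !mnmE => /val_inj.
pose f := \sum_k x k *: 'X_[mon k].
have f_size : (msize f <= D.+1)%N.
  apply: (big_ind (fun g : {mpoly F[n]} => (msize g <= D.+1)%N)); first by rewrite msize0.
    by move=> g h gf hf; rewrite (leq_trans (msizeD_le _ _)) // geq_max gf.
  move=> k _; rewrite (leq_trans (msizeZ_le _ _)) // msizeX ltnS mdegE.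
  apply: leq_trans (valP k); rewrite big_tuple.
  by apply: leq_sum => i _; rewrite mnmE.
exists f; split=> //.
  apply: contra_neq xk0 => f0; have /mpolyP/(_ (mon k0)) := f0.
  rewrite mcoeff0 raddf_sum /= (bigD1 k0) //= mcoeffZ mcoeffX eqxx mulr1 big1 ?addr0 //.
  by move=> k kk0; rewrite mcoeffZ mcoeffX (inj_eq mon_inj) (negbTE kk0) mulr0.
move=> p m pA mb; have [Dm|mD] := ltnP D (mdeg m).
  apply/memN_msupp_eq0/msize_mdeg_ge.
  exact: leq_trans (msize_comp_affine _ _ _) (leq_trans f_size Dm).
have m_lt i : (m i < D.+1)%N.
  by rewrite ltnS (leq_trans _ mD) // mdegE (bigD1 i) //= leq_addr.
have e_ok : (p \in A) && [forall i, ([ffun i => Ordinal (m_lt i)] i < b p i)%N].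
  by rewrite pA; apply/forallP => i; rewrite ffunE mb.
have := x_sol (exist _ (p, [ffun i => Ordinal (m_lt i)]) e_ok).
move=> sol; rewrite -[RHS]sol /f (raddf_sum (comp_mpoly _)) (raddf_sum (mcoeff m)); apply: eq_bigr => k _ /=.
rewrite comp_mpolyZ mcoeffZ /a /=; congr (_ * mcoeff _ _).
by apply/mnmP => i; rewrite mnmE ffunE.
Qed.

Lemma vanishing_order_exists (n : nat) (R : idomainType) (f : {mpoly R[n]}) :
  f != 0 -> exists2 m, f@_m != 0 & vanish_order_ge (mdeg m) f.
Proof.
move=> f0; have ex : exists k, has (fun m => mdeg m == k) (msupp f).
  exists (mdeg (mlead f)); apply/hasP; exists (mlead f) => //.
  exact: mlead_supp.
case: (ex_minnP ex) => k /hasP[m mf /eqP <-] k_min.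
exists m; first by rewrite -mcoeff_msupp.
by apply/allP => u uf; apply: k_min; apply/hasP; exists u.
Qed.

Lemma frames_vanishing (F : fieldType) (J T : finType) (l : 'I_3 -> J -> T)
    (c : J -> 'rV[F]_3) (E : J -> 'M[F]_3) :
  injective c -> (forall p, E p \in unitmx) ->
  (forall i p q, l i p = l i q -> exists t, c q = c p + t *: row i (E p)) ->
  vanishing_property l.
Proof.
move=> c_inj E_unit lines A D b few.
have [f [f0 f_size f_van]] := exists_vanishing_mpoly c E few.
pose h p := f \mPo affine_tuple (c p) (E p).
have h0 p : h p != 0.
  apply: contra_neq f0 => hp; rewrite -(comp_affine_id f).
  have <- : h p \mPo affine_tuple (- c p *m invmx (E p)) (invmx (E p)) =
      f \mPo affine_tuple 0 1%:M.
    by rewrite comp_affine_affine mulmxKV // mulVmx // addrN.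
  by rewrite hp comp_mpoly0.
have /choice[m m_prop] p : exists m, (h p)@_m != 0 /\ vanish_order_ge (mdeg m) (h p).
  by have [m ? ?] := vanishing_order_exists (h0 p); exists m.
(* A lowest-degree monomial [m p] of [f] in the frame at [p] supplies both the order and the
   exponent [g]. *)
exists (fun p => mdeg (m p)) => p pA.
have [hm vm] := m_prop p.
have [i bi] : exists i, (b p i <= m p i)%N.
  apply/existsP; apply: contraR hm => /existsPn mb; rewrite /h f_van // => i.
  by rewrite ltnNge mb.
exists i, (m p i); split=> //.
have /choice[t t_prop] q : exists t, q \in fiber l A i p -> c q = c p + t *: row i (E p).
  have [qf|] := boolP (q \in fiber l A i p); last by exists 0.
  by move: qf; rewrite inE => /andP[_ /eqP/esym/lines[t ->]]; exists t.
apply: (line_order_sum (t := t) (h := h p)) => //.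
- exact: leq_trans (msize_comp_affine _ _ _) f_size.
- move=> q r qf rf tqr; apply: c_inj.
  by rewrite t_prop // tqr -t_prop.
- move=> q qf; have [_ vq] := m_prop q.
  rewrite /h comp_affine_affine -scalemxAl -rowE -t_prop // mul1mx.
  (* Centred at [q], the frames of [p] and [q] differ by a linear map, which does not lower the
     order. *)
  have -> : f \mPo affine_tuple (c q) (E p) =
     h q \mPo affine_tuple 0 (E p *m invmx (E q)).
    by rewrite comp_affine_affine mul0mx addr0 mulmxKV.
  exact: vanish_order_ge_comp_linear.
Qed.

(** * Multijoints *)

From mathcomp Require Import finmap classical_sets cardinality reals.

Local Open Scope classical_set_scope.

Lemma span_unitmx (F : fieldType) (n : nat) (v : 'I_n -> 'rV[F]_n) :
  <<[seq v i | i : 'I_n]>>%VS = fullv -> \matrix_i v i \in unitmx.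
Proof.
move=> v_full; rewrite -row_full_unit -sub1mx; apply/row_subP => i.
have : row i 1%:M \in <<[seq v i | i : 'I_n]>>%VS by rewrite v_full memvf.
move=> /(coord_span (X := in_tuple _)) ->; apply: summx_sub => k _.
apply: scalemx_sub.
have /mapP[j _ ->] : (in_tuple [seq v i | i : 'I_n])`_k \in [seq v i | i : 'I_n].
  exact: mem_nth.
by rewrite -(rowK v j) row_sub.
Qed.

Lemma is_direction_line (F : fieldType) (n : nat) (l : set 'rV[F]_n) v x y :
  is_direction l v -> l x -> l y -> exists t, y = x + t *: v.
Proof.
move=> [_ [p ->]] [s _ <-] [t _ <-]; exists (t - s).
by rewrite -addrA -scalerDl [s + _]addrC subrK.
Qed.

Lemma multijoint_frame (F : fieldType) (n : nat) (L : 'I_n -> {fset set 'rV[F]_n}) x :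
  multijoints L x -> exists (l : 'I_n -> set 'rV[F]_n) (E : 'M[F]_n),
    [/\ forall i, l i \in L i, forall i, l i x, E \in unitmx &
        forall i, is_direction (l i) (row i E)].
Proof.
move=> [l [lL [v [dir_v /span_unitmx Ev]]]]; exists l, (\matrix_i v i); split=> //.
- by move=> i; have [] := lL i.
- by move=> i; have [] := lL i.
- by move=> i; rewrite rowK.
Qed.

(** Two of the lines, with independent directions, already meet at most once. *)
Lemma frame_lines_meet (F : fieldType) (l : 'I_3 -> set 'rV[F]_3) (E : 'M[F]_3) x y :
  E \in unitmx -> (forall i, is_direction (l i) (row i E)) ->
  (forall i, l i x) -> (forall i, l i y) -> y = x.
Proof.
move=> Eu dir lx ly.
have [s ys] := is_direction_line (dir ord0) (lx ord0) (ly ord0).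
have [t yt] := is_direction_line (dir ord_max) (lx ord_max) (ly ord_max).
have : (s *: delta_mx 0 ord0 : 'rV_3) *m E = (t *: delta_mx 0 ord_max : 'rV_3) *m E.
  by rewrite -!scalemxAl -!rowE; apply: (addrI x); rewrite -ys -yt.
move=> /(can_inj (mulmxK Eu))/matrixP/(_ 0 ord0).
by rewrite !mxE eqxx /= mulr1 mulr0 ys => ->; rewrite scale0r addr0.
Qed.

Lemma finite_multijoints (F : fieldType) (L : 'I_3 -> {fset set 'rV[F]_3}) :
  finite_set (multijoints L).
Proof.
pose U := (\bigcup_(i in 'I_3) L i)%fset.
(* A multijoint is recovered from its triple of lines, of which there are finitely many; triples
   without a common point get the default 0. *)
pose meet (l : {ffun 'I_3 -> U}) := xget 0 [set x | forall i, val (l i) x].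
apply: (@sub_finite_set _ _ (range meet)); last exact/finite_image/finite_finset.
move=> x /multijoint_frame[l [E [lL lx Eu dir]]].
have lU i : l i \in U by apply/bigfcupP; exists i; rewrite ?mem_index_enum.
exists [ffun i => [` lU i]%fset] => //; apply: (frame_lines_meet Eu dir lx) => i.
have /(xgetI 0)/(_ i) : [set y | forall i, val ([ffun i => [` lU i]%fset] i) y] x.
  by move=> j /=; rewrite ffunE; exact: lx.
by rewrite {1}ffunE.
Qed.

Lemma multijoints_bound (F : fieldType) (L : 'I_3 -> {fset set 'rV[F]_3}) :
  (#|` fset_set (multijoints L)| ^ 2 <= 10 * \prod_i #|` L i|)%N.
Proof.
pose J := fset_set (multijoints L); pose U := (\bigcup_(i in 'I_3) L i)%fset.
(* One triple of lines and one frame are fixed per multijoint; the chosen i-th lines all lie in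
   [L i], which bounds their number. *)
have /choice[r rP] (p : J) : exists r : ('I_3 -> U) * 'M[F]_3,
    [/\ forall i, val (r.1 i) \in L i, forall i, val (r.1 i) (val p), r.2 \in unitmx &
        forall i, is_direction (val (r.1 i)) (row i r.2)].
  have : val p \in J := valP p.
  rewrite in_fset_set; last exact: finite_multijoints.
  rewrite inE => /multijoint_frame[l [E [lL lx Eu dir]]].
  have lU i : l i \in U by apply/bigfcupP; exists i; rewrite ?mem_index_enum.
  by exists (fun i => [` lU i]%fset, E).
pose l i (p : J) := (r p).1 i.
have vanish : vanishing_property l.
  apply: (@frames_vanishing F _ _ _ val (fun p => (r p).2)) => [|p|i p q lpq].
  - exact: val_inj.
  - by have [] := rP p.
  - have [_ lp _ dir] := rP p; have [_ lq _ _] := rP q.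
    by apply: is_direction_line (dir i) (lp i) _; have := lq i; rewrite -/(l i q) -lpq.
have := vanishing_bound [set: J] vanish; rewrite cardsT -cardfE => /leq_trans; apply.
rewrite leq_mul2l; apply: leq_prod => i _.
rewrite cardE -(size_map val); apply: uniq_leq_size.
  by rewrite map_inj_uniq ?enum_uniq //; exact: val_inj.
move=> _ /mapP[u + ->]; rewrite mem_enum => /imsetP[p _ ->].
by have [rL _ _ _] := rP p; exact: rL.
Qed.

Local Open Scope fset_scope.

Theorem theorem1 (R : realType) :
  exists c : R,
    forall (F : fieldType) (L1 L2 L3 : {fset (set 'rV[F]_3)}),
      (forall l, l \in L1 -> is_line l) ->
      (forall l, l \in L2 -> is_line l) ->
      (forall l, l \in L3 -> is_line l) ->
      let J := multijoints (tnth [tuple L1; L2; L3]) in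
      finite_set J /\
      #|` fset_set J|%:R <=
        c * Num.sqrt (#|` L1|%:R * #|` L2|%:R * #|` L3|%:R).
Proof.
(* The square root of the factor 10 in [multijoints_bound]. *)
exists (Num.sqrt 10) => F L1 L2 L3 _ _ _ J; split; first exact: finite_multijoints.
have := multijoints_bound (tnth [tuple L1; L2; L3]); rewrite -/J.
rewrite !big_ord_recl big_ord0 !(tnth_nth fset0) /= muln1 !mulnA -!(mulnA 10) => J_le.
rewrite -sqrtrM // -[leLHS]ger0_norm // -sqrtr_sqr ler_sqrt ?mulr_ge0 //.
by rewrite -!natrM -natrX ler_nat.
Qed.
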